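(* Let $q$ be a prime power, $r\ge1$, $H=\{0,1,\dots,q-2\}^r\subset\mathbb Z^r$, let $U\subseteq H$ be nonempty, and let $U+U=\{u_1+u_2: u_1,u_2\in U\}$ be the Minkowski sum. Let $\mathcal M(U)$ be the linear secret sharing scheme with support $T(\mathbb F_q)=(\mathbb F_q^* )^r$ and $n=(q-1)^r-1$ players, and let $t(U)$ be its privacy (adversary) threshold. If $t\le t(U)$ and $$t\ \le\ n-1-\#\{P\in T(\mathbb F_q): h(P)=0\}$$ for all $h\in\mathbb F_q\langle U+U\rangle$ that do not vanish identically on $T(\mathbb F_q)$, then $\mathcal M(U)$ has strong multiplication with respect to $\mathcal A_{t,n}$.
   Context: $\mathbb F_q$ is the finite field with $q$ elements, $\mathbb F_q^*=\mathbb F_q\setminus\{0\}$, and $T(\mathbb F_q)=(\mathbb F_q^* )^r$. For $U\subseteq\mathbb Z^r$, $\mathbb F_q\langle U\rangle$ denotes the $\mathbb F_q$-linear span in $\mathbb F_q[X_1^{\pm1},\dots,X_r^{\pm1}]$ of the monomials $X^u=X_1^{u_1}\cdots X_r^{u_r}$, $u=(u_1,\dots,u_r)\in U$. The scheme $\mathcal M(U)$ with support $T(\mathbb F_q)$: fix a point $P_0\in T(\mathbb F_q)$. The players are the $n=|T(\mathbb F_q)|-1$ points of $T(\mathbb F_q)\setminus\{P_0\}$. To share a secret $s_0\in\mathbb F_q$, choose $f\in\mathbb F_q\langle U\rangle$ at random subject to $f(P_0)=s_0$; the share of player $P$ is $f(P)$. A set $A$ of players determines the secret if, for $f\in\mathbb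 F_q\langle U\rangle$, the value $f(P_0)$ is uniquely determined by the values $(f(P))_{P\in A}$, i.e. if any two $f,f'\in\mathbb F_q\langle U\rangle$ with $f(P)=f'(P)$ for all $P\in A$ satisfy $f(P_0)=f'(P_0)$. The privacy threshold $t(U)$ is the largest integer $t\le n$ such that no set of $t$ or fewer players determines the secret. $\mathcal A_{t,n}$ is the adversary structure consisting of all sets of at most $t$ of the $n$ players. The scheme has strong multiplication with respect to $\mathcal A_{t,n}$ if (1) no set in $\mathcal A_{t,n}$ determines the secret, and (2) for every $A\in\mathcal A_{t,n}$ and all $f,g\in\mathbb F_q\langle U\rangle$, the products of shares $f(P)g(P)$ for all players $P\notin A$ uniquely determine the product of secrets $f(P_0)g(P_0)$. *)

(* Defs.v *)
From HB Require Import structures.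
From mathcomp Require Import all_boot all_order all_algebra.
From mathcomp Require Import finmap boolp.
From mathcomp.multinomials Require Import monalg.

Set Implicit Arguments.
Unset Strict Implicit.
Unset Printing Implicit Defensive.

Import Order.TTheory GRing.Theory Num.Theory.
Local Open Scope fset_scope.
Local Open Scope ring_scope.

(* The library has no multivariate Laurent polynomials. As an F-vector space,
   F[X_1^{+-1}, .., X_r^{+-1}] is free on its monomials X^u, u in Z^r; here
   << u >> is X^u. The ring product of Laurent polynomials is not needed: the
   scheme only multiplies values. *)
Definition laurent (F : fieldType) (r : nat) := {malg F['rV[int]_r]}.

Definition torus (F : finFieldType) (r : nat) := {ffun 'I_r -> {unit F}}.

Section Scheme.
Variables (F : finFieldType) (r : nat).

Definition monom_eval (u : 'rV[int]_r) (P : torus F r) : F :=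
  \prod_(i < r) (val (P i) ^ u 0 i).

Definition leval (f : laurent F r) (P : torus F r) : F :=
  \sum_(u <- msupp f) f@_u * monom_eval u P.

Definition lspan (U : {fset 'rV[int]_r}) (f : laurent F r) : Prop :=
  exists c : 'rV[int]_r -> F, f = \sum_(u <- U) c u *: << u >>.

Definition minkowski (U V : {fset 'rV[int]_r}) : {fset 'rV[int]_r} :=
  [fset u + v | u in U, v in V].

Definition players (P0 : torus F r) : {set torus F r} := [set~ P0].

Definition determines (U : {fset 'rV[int]_r}) (P0 : torus F r)
    (A : {set torus F r}) : Prop :=
  forall f f' : laurent F r, lspan U f -> lspan U f' ->
    (forall P, P \in A -> leval f P = leval f' P) ->
    leval f P0 = leval f' P0.

Definition adversary (P0 : torus F r) (t : nat) : {set {set torus F r}} :=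
  [set A : {set torus F r} | (A \subset players P0) && (#|A| <= t)%N].

Definition private (U : {fset 'rV[int]_r}) (P0 : torus F r)
    (AA : {set {set torus F r}}) : Prop :=
  forall A, A \in AA -> ~ determines U P0 A.

(* The maximum is 0 if no t qualifies, which happens only for empty U: see
   threshold_private. *)
Definition threshold (U : {fset 'rV[int]_r}) (P0 : torus F r) : nat :=
  \max_(t < #|players P0|.+1 | `[< private U P0 (adversary P0 t) >]) t.

(* "The products of shares determine the product of secrets" means that two
   pairs (f, g), (f', g') with the same products outside A have the same
   product at P0. *)
Definition strong_multiplication (U : {fset 'rV[int]_r}) (P0 : torus F r)
    (AA : {set {set torus F r}}) : Prop :=
  private U P0 AA /\
  forall A, A \in AA ->
  forall f g f' g' : laurent F r,
    lspan U f -> lspan U g -> lspan U f' -> lspan U g' ->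
    (forall P, P \in players P0 :\: A ->
       leval f P * leval g P = leval f' P * leval g' P) ->
    leval f P0 * leval g P0 = leval f' P0 * leval g' P0.

Lemma monom_eval_neq0 u P : monom_eval u P != 0.
Proof.
apply/prodf_neq0 => i _; apply: expfz_neq0.
by have := valP (P i); rewrite unitfE.
Qed.

Lemma leval_monom u P : leval << u >> P = monom_eval u P.
Proof. by rewrite /leval msuppU oner_eq0 big_seq_fset1 mcoeffUU mul1r. Qed.

Lemma lspan_monom U u : u \in U -> lspan U << u >>.
Proof.
move=> uU; exists (fun v => (v == u)%:R).
rewrite (big_fsetD1 u uU) /= eqxx scale1r big_seq big1 ?addr0 // => v.
by rewrite !inE => /andP[/negPf-> _]; rewrite scale0r.
Qed.

Lemma lspan0 U : lspan U 0.
Proof. by exists (fun=> 0); rewrite big1 // => u _; rewrite scale0r. Qed.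

Lemma leval0 P : leval 0 P = 0.
Proof. by rewrite /leval msupp0 big_seq_fset0. Qed.

Lemma threshold_private U P0 :
  U != fset0 -> private U P0 (adversary P0 (threshold U P0)).
Proof.
case/fset0Pn => u uU.
have p0 : `[< private U P0 (adversary P0 (ord0 : 'I_#|players P0|.+1)) >].
  apply/asboolP => A; rewrite inE leqn0 cards_eq0 => /andP[_ /eqP->] det.
  have := monom_eval_neq0 u P0; rewrite -leval_monom.
  rewrite (det _ 0 (lspan_monom uU) (lspan0 U)) ?leval0 ?eqxx // => P.
  by rewrite inE.
have [|t /asboolP pt] := @eq_bigmax_cond 'I_#|players P0|.+1
  [pred t | `[< private U P0 (adversary P0 (t : 'I__)) >]] (@nat_of_ord _).
  by apply/card_gt0P; exists ord0.
by rewrite -[\max_(_ in _) _]/(threshold U P0) => ->.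
Qed.

Lemma threshold_max U P0 t : (t <= #|players P0|)%N ->
  private U P0 (adversary P0 t) -> (t <= threshold U P0)%N.
Proof.
move=> tn pt; have tn1 : (t < #|players P0|.+1)%N by [].
rewrite -[t]/(val (Ordinal tn1)).
by apply: (@leq_bigmax_cond _ _ (@nat_of_ord _)); apply/asboolP.
Qed.

End Scheme.

(* Main.v *)
(* If f g and f' g' agree outside A, then h = f g - f' g' lies in the span of
   U + U and vanishes at the at least n - t players outside A. If h(P0) were
   nonzero, the hypothesis on h would give t <= n - 1 - (n - t) = t - 1. *)


Require Import Defs.
From mathcomp Require Import all_boot all_order all_algebra.
From mathcomp Require Import finmap boolp.
From mathcomp.multinomials Require Import monalg.
From mathcomp Require Import finfield zify.

Set Implicit Arguments.
Unset Strict Implicit.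
Unset Printing Implicit Defensive.

Import Order.TTheory GRing.Theory Num.Theory.
Local Open Scope ring_scope.

Section LaurentEvaluation.
Variables (F : finFieldType) (r : nat).
Implicit Types (f g h : laurent F r) (u v : 'rV[int]_r) (P : torus F r).
Implicit Types (U V : {fset 'rV[int]_r}).

(** The coordinates of a torus point are units, so the exponent law holds for all integer exponents,
    negative ones included. *)
Lemma monom_evalD u v P :
  monom_eval (u + v) P = monom_eval u P * monom_eval v P.
Proof.
rewrite /monom_eval -big_split; apply: eq_bigr => i _ /=.
by rewrite mxE expfzDr // -unitfE; apply: valP.
Qed.

(** Exponents outside the support have coefficient 0. Supports can shrink under sums and scalings,
    so linearity of evaluation is proved by moving all terms to one common index set. *)
Lemma leval_sub (S : {fset 'rV[int]_r}) f P : (msupp f `<=` S)%fset ->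
  leval f P = \sum_(u <- S) f@_u * monom_eval u P.
Proof.
move=> sfS; rewrite /leval; apply: big_fset_incl => // u _ uNf.
by rewrite mcoeff_outdom // mul0r.
Qed.

Lemma levalD f g P : leval (f + g) P = leval f P + leval g P.
Proof.
rewrite (leval_sub _ (msuppD_le f g)) (leval_sub _ (fsubsetUl _ (msupp g))).
rewrite (leval_sub _ (fsubsetUr (msupp f) _)) -big_split.
by apply: eq_bigr => u _ /=; rewrite mcoeffD mulrDl.
Qed.

Lemma levalZ (a : F) f P : leval (a *: f) P = a * leval f P.
Proof.
rewrite (leval_sub _ (msuppZ_le a f)) /leval big_distrr.
by apply: eq_bigr => u _ /=; rewrite mcoeffZ mulrA.
Qed.

Lemma levalB f g P : leval (f - g) P = leval f P - leval g P.
Proof. by rewrite -scaleN1r levalD levalZ mulN1r. Qed.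

Lemma leval_sum (I : Type) (s : seq I) (G : I -> laurent F r) P :
  leval (\sum_(i <- s) G i) P = \sum_(i <- s) leval (G i) P.
Proof.
by elim: s => [|i s IHs]; rewrite ?big_nil ?leval0 // !big_cons levalD IHs.
Qed.

Lemma leval_comb U (c : 'rV[int]_r -> F) P :
  leval (\sum_(u <- U) c u *: << u >>) P = \sum_(u <- U) c u * monom_eval u P.
Proof.
by rewrite leval_sum; apply: eq_bigr => u _; rewrite levalZ leval_monom.
Qed.

Lemma lspanD U f g : lspan U f -> lspan U g -> lspan U (f + g).
Proof.
move=> [c ->] [d ->]; exists (fun u => c u + d u).
by rewrite -big_split; apply: eq_bigr => u _ /=; rewrite scalerDl.
Qed.

Lemma lspanZ U (a : F) f : lspan U f -> lspan U (a *: f).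
Proof.
move=> [c ->]; exists (fun u => a * c u).
by rewrite scaler_sumr; apply: eq_bigr => u _; rewrite scalerA.
Qed.

Lemma lspanB U f g : lspan U f -> lspan U g -> lspan U (f - g).
Proof. by rewrite -scaleN1r => Uf Ug; apply/lspanD/lspanZ. Qed.

Lemma lspan_sum U (I : eqType) (s : seq I) (G : I -> laurent F r) :
  {in s, forall i, lspan U (G i)} -> lspan U (\sum_(i <- s) G i).
Proof.
move=> UG; rewrite big_seq; apply: (big_ind (lspan U)) => //.
- exact: lspan0.
- exact: lspanD.
Qed.

(** The product enters only through its values: expanding both combinations gives a Laurent
    polynomial with exponents in the Minkowski sum. *)
Lemma lspan_mul U V f g : lspan U f -> lspan V g ->
  exists2 h, lspan (minkowski U V) h &
    forall P, leval h P = leval f P * leval g P.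
Proof.
move=> [c ->] [d ->].
(* Different pairs may share the exponent [u + v]; closure of the span under sums makes collecting
   their coefficients unnecessary. *)
exists (\sum_(u <- U) \sum_(v <- V) (c u * d v) *: << u + v >>).
  apply: lspan_sum => u uU; apply: lspan_sum => v vV.
  by apply/lspanZ/lspan_monom/imfset2P; exists u => //; exists v.
move=> P; rewrite !leval_comb leval_sum mulr_suml; apply: eq_bigr => u _.
rewrite leval_sum mulr_sumr; apply: eq_bigr => v _.
by rewrite levalZ leval_monom monom_evalD mulrACA.
Qed.

Lemma adversary_sub (P0 : torus F r) (s t : nat) : (s <= t)%N ->
  adversary P0 s \subset adversary P0 t.
Proof.
move=> st; apply/subsetP => A; rewrite !inE => /andP[-> /=].
by move/leq_trans; apply.
Qed.

Lemma card_players (P0 : torus F r) : #|players P0| = ((#|F| - 1) ^ r - 1)%N.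
Proof.
by rewrite cardsC1 card_ffun card_ord -cardsT card_finField_unit !subn1.
Qed.

End LaurentEvaluation.

Theorem theorem3p7 (F : finFieldType) (q r n t : nat)
    (hq : #|F| = q) (hr : (1 <= r)%N) (hn : n = ((q - 1) ^ r - 1)%N)
    (U : {fset 'rV[int]_r}) (hU0 : U != fset0)
    (hU : forall u, u \in U -> forall i, 0 <= u 0 i <= q%:Z - 2)
    (P0 : torus F r)
    (ht : (t <= threshold U P0)%N)
    (hmul : forall h : laurent F r, lspan (minkowski U U) h ->
       ~ (forall P, leval h P = 0) ->
       t%:Z <= n%:Z - 1 - #|[set P : torus F r | leval h P == 0]|%:Z) :
  strong_multiplication U P0 (adversary P0 t).
Proof.
split.
  (* Privacy at the threshold passes down to every smaller [t]. *)
  by move=> A /(subsetP (adversary_sub P0 ht)); apply: threshold_private.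
move=> A; rewrite inE => /andP[sA cA] f g f' g' Uf Ug Uf' Ug' eqfg.
have [h1 Uh1 h1E] := lspan_mul Uf Ug.
have [h2 Uh2 h2E] := lspan_mul Uf' Ug'.
rewrite -h1E -h2E; apply/eqP; rewrite -subr_eq0 -levalB; apply/negPn/negP => h0.
(* The point [P0] witnesses that the difference does not vanish identically, as [hmul] requires. *)
have hNz : ~ forall P, leval (h1 - h2) P = 0.
  by move=> hz; rewrite hz eqxx in h0.
have := hmul _ (lspanB Uh1 Uh2) hNz.
set Z := [set P | _] => tZ.
have : players P0 :\: A \subset Z.
  apply/subsetP => P PA.
  by rewrite inE levalB h1E h2E eqfg // subrr.
move/subset_leq_card.
(* Since [A] consists of players, exactly [#|A|] of the [n] players are removed. *)
rewrite cardsD (setIidPr sA) card_players hq -hn.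
(* With [z] zeros and [a] corrupted players, [n <= z + a <= z + t] contradicts [t + 1 + z <= n]; the
   [- 1] in [hmul] makes the clash strict. *)
by move: #|Z| #|A| cA tZ => z a; lia.
Qed.
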